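(* Let $n\ge3$, let $g,f\in\mathbb{Z}[[z]]$ with $f(0)=0$, and let $G_n^\sigma=G_n^\sigma(g,f)$ be the oriented Riordan graph of order $n$ with vertex set $V=\{1,\dots,n\}=V_1\cup V_2\cup V_3$, where $V_i=\{j\in\{1,\dots,n\} : j\equiv i \pmod 3\}$. Put $\ell_i=\lfloor (n-i)/3\rfloor+1$ for $i=1,2,3$. Then the skew-adjacency matrix $\mathcal{S}(G_n^\sigma)$ is permutationally similar to the $3\times3$ block matrix $$\begin{pmatrix} X_1 & B_{1,2} & B_{1,3}\\ -B_{1,2}^T & X_2 & B_{2,3}\\ -B_{1,3}^T & -B_{2,3}^T & X_3\end{pmatrix},$$ where $X_i=\mathcal{S}(\langle V_i\rangle)$ is the skew-adjacency matrix of the subgraph of $G_n^\sigma$ induced by $V_i$, $i=1,2,3$. In particular, $\langle V_i\rangle$ is isomorphic to the oriented Riordan graph of order $\ell_i$ given by $$G^\sigma_{\ell_i}\left(-\frac{d^{2}}{dz^{2}}\left(\frac{gf^{i-1}}{z^{i-1}}\right)(\sqrt[3]{z}),\,f(z)\right),$$ and, for $1\le i<j\le3$, the block $B_{i,j}$, which represents the edges between $V_i$ and $V_j$, can be expressed as the sum of two Riordan matrices as follows: $$B_{i,j}\equiv\left(-z\frac{d^{2}}{dz^{2}}\left(\frac{gf^{j-1}}{z^{i-1}}\right)(\sqrt[3]{z}),\,f(z)\right)_{\ell_i\times\ell_j}+\left(\frac{d^{2}}{dz^{2}}\left(z^{4-j}gf^{i-1}\right)(\sqrt[3]{z}),\,f(z)\right)_{\ell_j\times\ell_i}^{T}\pmod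 3 .$$
   Context: The skew-adjacency matrix of an oriented graph on $\{1,\dots,n\}$ is $\mathcal{S}=[s_{i,j}]$ with $s_{i,j}=1$, $s_{j,i}=-1$ if $i\to j$ is an arc, and $s_{i,j}=s_{j,i}=0$ if there is no arc between $i$ and $j$; for induced subgraphs the vertices are taken in increasing order. For $g,f$ with $f(0)=0$, the oriented Riordan graph $G_n^\sigma(g,f)$ is the oriented graph on $\{1,\dots,n\}$ whose skew-adjacency matrix has entries in $\{-1,0,1\}$ with $s_{i,j}\equiv[z^{i-2}]\,g f^{\,j-1}\pmod 3$ for $i>j$ (and $s_{j,i}=-s_{i,j}$, $s_{i,i}=0$); it depends only on $g,f$ modulo $3$. The Riordan matrix $(h,f)$ is the infinite lower triangular matrix $[\ell_{i,j}]_{i,j\ge0}$ with $\ell_{i,j}=[z^i]\,h f^j$; $(h,f)_{a\times b}$ denotes its leading $a\times b$ submatrix (first $a$ rows, first $b$ columns). For a power series $h=\sum_{m\ge0} h_mz^m\in\mathbb{Z}[[z]]$, the notation $\frac{d^2}{dz^2}(h)(\sqrt[3]{z})$ means: take the second derivative $h''(z)$ and then substitute $\sqrt[3]{z}$ for $z$. Modulo $3$, $h''(z)$ is a power series in $z^3$, so the result is regarded as a power series in $z$ modulo $3$. The series $gf^{i-1}/z^{i-1}$ and $gf^{j-1}/z^{i-1}$ ($i<j$) are power series because $f(0)=0$. Two $n\times n$ matrices $M,N$ are permutationally similar if $N=PMP^T$ for some permutation matrix $P$. *)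

(* Defs.v *)
From HB Require Import structures.
From mathcomp Require Import all_boot all_order all_fingroup all_algebra.
From mathcomp Require Import zify ring.

Set Implicit Arguments.
Unset Strict Implicit.
Unset Printing Implicit Defensive.

Import Order.TTheory GRing.Theory Num.Theory.

Local Open Scope ring_scope.

(* Z[[z]]: a formal power series is its coefficient sequence, p m = [z^m] p *)
Definition fps := nat -> int.

Definition fps_one : fps := fun m => (m == 0%N)%:Z.
Definition fps_opp (p : fps) : fps := fun m => - p m.
Definition fps_mul (p q : fps) : fps :=
  fun m => \sum_(k < m.+1) p k * q (m - k)%N.
Definition fps_exp (p : fps) (k : nat) : fps := iter k (fps_mul p) fps_one.
Definition fps_deriv (p : fps) : fps := fun m => m.+1%:Z * p m.+1.

Definition fps_mulXn (k : nat) (p : fps) : fps :=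
  fun m => if (m < k)%N then 0 else p (m - k)%N.

(* p / z^k; meaningful when z^k divides p, see fps_divXnK *)
Definition fps_divXn (k : nat) (p : fps) : fps := fun m => p (m + k)%N.

(* h''(z^(1/3)): only the coefficients of z^0, z^3, z^6, ... of h'' are kept,
   the other ones being 0 modulo 3 by deriv2_mod3 *)
Definition deriv2_cbrt (h : fps) : fps :=
  fun m => fps_deriv (fps_deriv h) (3 * m)%N.

Lemma deriv2_mod3 (h : fps) (m : nat) :
  ~~ (3 %| m)%N -> (fps_deriv (fps_deriv h) m = 0 %[mod 3])%Z.
Proof.
move=> m3; apply/eqP; rewrite eqz_mod_dvd subr0 /fps_deriv mulrA dvdz_mulr //.
by rewrite -PoszM; apply/dvdnP; exists ((m.+1 * m.+2) %/ 3)%N; nia.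
Qed.

Lemma fps_mul_exp_low (g f : fps) (k m : nat) :
  f 0%N = 0 -> (m < k)%N -> fps_mul g (fps_exp f k) m = 0.
Proof.
move=> f0 mk; apply: big1 => i _.
have H : forall k m, (m < k)%N -> fps_exp f k m = 0.
  elim=> // k' IH m' mk'; rewrite /fps_exp iterS -/(fps_exp f k').
  apply: big1 => [[[|l] Hl]] _ /=; first by rewrite f0 mul0r.
  by rewrite IH ?mulr0 //; lia.
by rewrite H ?mulr0 //; have := ltn_ord i; lia.
Qed.

Lemma fps_divXnK (g f : fps) (j k : nat) : f 0%N = 0 -> (k <= j)%N ->
  fps_mulXn k (fps_divXn k (fps_mul g (fps_exp f j)))
    =1 fps_mul g (fps_exp f j).
Proof.
move=> f0 kj m; rewrite /fps_mulXn /fps_divXn; case: ltnP => mk.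
  by rewrite fps_mul_exp_low //; lia.
by rewrite subnK.
Qed.

(* (h, f)_{a x b} *)
Definition riordan_mx (h f : fps) (a b : nat) : 'M[int]_(a, b) :=
  \matrix_(i < a, j < b) fps_mul h (fps_exp f j) i.

(* Oriented graphs on {1, ..., n}: the vertex v is encoded by v - 1 : 'I_n.
   Asymmetry also excludes loops. *)
Record ograph (n : nat) := OGraph {
  arc :> rel 'I_n;
  arc_asym : forall u v, arc u v -> ~~ arc v u }.

Definition skew_adj n (G : ograph n) : 'M[int]_n :=
  \matrix_(u, v) (if G u v then 1 else if G v u then -1 else 0).

Definition ograph_iso m n (G : ograph m) (H : ograph n) : Prop :=
  exists2 phi : 'I_m -> 'I_n,
    bijective phi & forall u v, G u v = H (phi u) (phi v).

(* enum A is increasing for A : {set 'I_n}, hence so is enum_val *)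
Definition induced n (G : ograph n) (A : {set 'I_n}) : ograph #|A| :=
  @OGraph #|A| (fun a b => G (enum_val a) (enum_val b))
    (fun a b => @arc_asym n G (enum_val a) (enum_val b)).

(* The rectangular submatrix of the skew-adjacency matrix with rows A and
   columns C *)
Definition edge_block n (G : ograph n) (A C : {set 'I_n}) :
    'M[int]_(#|A|, #|C|) :=
  \matrix_(a, c) skew_adj G (enum_val a) (enum_val c).

(* With the encoding above, the condition s_{i,j} = [z^(i-2)] g f^(j-1) for
   i = u + 1 > j = v + 1 reads s_{u,v} = [z^(u-1)] g f^v. *)
Definition oriordan_arc n (g f : fps) : rel 'I_n := fun u v =>
  if (v < u)%N then (fps_mul g (fps_exp f v) u.-1 == 1 %[mod 3])%Z
  else if (u < v)%N then (fps_mul g (fps_exp f u) v.-1 == -1 %[mod 3])%Z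
  else false.

Lemma oriordan_arc_asym n (g f : fps) (u v : 'I_n) :
  oriordan_arc g f u v -> ~~ oriordan_arc g f v u.
Proof.
by rewrite /oriordan_arc; case: ltngtP => // _ /eqP->.
Qed.

Definition oriordan n (g f : fps) : ograph n :=
  OGraph (@oriordan_arc_asym n g f).

Lemma skew_adj_oriordan n (g f : fps) (u v : 'I_n) : (v < u)%N ->
  (skew_adj (oriordan n g f) u v = fps_mul g (fps_exp f v) u.-1 %[mod 3])%Z.
Proof.
move=> vu; rewrite mxE /= /oriordan_arc vu [(u < v)%N]ltnNge (ltnW vu) /=.
case: eqP => [->//|h1]; case: eqP => [->//|h2].
by move: h1 h2; set x := fps_mul _ _ _; lia.
Qed.

Definition perm_similar n (M N : 'M[int]_n) : Prop :=
  exists2 P : 'M[int]_n, is_perm_mx P & N = P *m M *m P^T.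

Definition eqmx_mod3 a b (M N : 'M[int]_(a, b)) : Prop :=
  forall i j, (M i j = N i j %[mod 3])%Z.

Definition residue_class (n i : nat) : {set 'I_n} :=
  [set v : 'I_n | v.+1 == i %[mod 3]].

(* The truncated n - i is the exact one when i <= n *)
Definition ell (n i : nat) : nat := ((n - i) %/ 3 + 1)%N.

(* Main.v *)
(* Since f(z)^3 = f(z^3) modulo 3, the coefficient of z^(3a+s) in
   z g f^(3b+r), which is an entry of the skew-adjacency matrix below the
   diagonal, is modulo 3 the coefficient of z^a in h f^b, where h collects the
   coefficients of z g f^r at exponents congruent to s modulo 3. As
   (3m+1)(3m+2) = -1 modulo 3, such a section is, up to sign and a shift, a
   second derivative evaluated at the cube root of z. A block B_(i,j) has
   entries on both sides of the diagonal; each of the two Riordan matrices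
   vanishes on the side governed by the other one. *)

Require Import Defs.
From HB Require Import structures.
From mathcomp Require Import all_boot all_order all_fingroup all_algebra.
From mathcomp Require Import zify ring.

Set Implicit Arguments.
Unset Strict Implicit.
Unset Printing Implicit Defensive.

Import Order.TTheory GRing.Theory Num.Theory.

Local Open Scope ring_scope.

(** * Power series modulo 3 as truncated polynomials over ['F_3] *)

Lemma eqz_mod3E (x y : int) :
  (x = y %[mod 3])%Z <-> x%:~R = y%:~R :> 'F_3.
Proof.
have ch3 : 3%N \in [pchar 'F_3] by exact: pchar_Fp.
have E : (x == y %[mod 3])%Z = (x%:~R == y%:~R :> 'F_3).
  by rewrite eqz_mod_dvd (dvdz_pcharf ch3) intrB subr_eq0.
by split=> /eqP H; apply/eqP; rewrite ?E // -E.
Qed.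

(** Cubing is additive in characteristic 3 and fixes the constants, so it acts on the variable
    alone. *)
Lemma exp3_poly_F3 (P : {poly 'F_3}) : P ^+ 3 = P \Po 'X^3.
Proof.
have ch3 : 3%N \in [pchar {poly 'F_3}] by rewrite pchar_poly pchar_Fp.
elim/poly_ind: P => [|P c IH]; first by rewrite comp_poly0 expr0n.
rewrite comp_polyD comp_polyM comp_polyX comp_polyC -IH -exprMn.
rewrite -!(pFrobenius_autE ch3) rmorphD /=; congr (_ + _).
rewrite pFrobenius_autE -rmorphXn /=; congr _%:P.
by apply: val_inj; case: c => [[|[|[|]]]].
Qed.

(** Since coefficients of a product below index N involve only factor coefficients below N,
    computations on [fps] can be moved to the ring [{poly 'F_3}]. *)
Definition trunc_rep (N : nat) (p : fps) (P : {poly 'F_3}) : Prop :=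
  forall m, (m < N)%N -> (p m)%:~R = P`_m.

Lemma trunc_rep_poly N p : trunc_rep N p (\poly_(i < N) (p i)%:~R).
Proof. by move=> m mN; rewrite coef_poly mN. Qed.

Lemma trunc_rep_mul N p q P Q :
  trunc_rep N p P -> trunc_rep N q Q -> trunc_rep N (fps_mul p q) (P * Q).
Proof.
move=> hp hq m mN; rewrite coefM rmorph_sum; apply: eq_bigr => k _ /=.
have := ltn_ord k; rewrite ltnS => km.
by rewrite rmorphM /= hp ?hq //; lia.
Qed.

Lemma trunc_rep_exp N p P k :
  trunc_rep N p P -> trunc_rep N (fps_exp p k) (P ^+ k).
Proof.
move=> hp; elim: k => [|k IH].
  by move=> m mN; rewrite expr0 coef1 /fps_exp /= /fps_one; case: m mN.
by rewrite exprS; apply: trunc_rep_mul.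
Qed.

(** * Trisection of a convolution *)

Lemma sum_ord_mul3 (V : nmodType) (F : nat -> V) a s : (s < 3)%N ->
  \sum_(k < (3 * a + s).+1 | (3 %| k)%N) F (k %/ 3)%N = \sum_(k < a.+1) F k.
Proof.
move=> s3; elim: a => [|a IH].
  rewrite muln0 add0n big_ord1; case: s s3 => [|[|[|//]]] _.
  - by rewrite big_mkcond /= big_ord1.
  - by rewrite big_mkcond /= !big_ord_recr big_ord0 /= add0r addr0.
  - by rewrite big_mkcond /= !big_ord_recr big_ord0 /= add0r !addr0.
rewrite (_ : (3 * a.+1 + s).+1 = (3 * a + s).+4)%N; last by lia.
rewrite big_mkcond big_ord_recr big_ord_recr big_ord_recr /= -big_mkcond /= IH.
rewrite [RHS]big_ord_recr /= -!addrA; congr (_ + _).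
(* Of the three new indices only 3a+3 is a multiple of 3; its position among them depends on s. *)
case: s s3 {IH} => [|[|[|//]]] _.
- have -> : (3 %| (3 * a + 0).+1 = false)%N by lia.
  have -> : (3 %| (3 * a + 0).+2 = false)%N by lia.
  have -> : (3 %| (3 * a + 0).+3)%N by lia.
  by rewrite !add0r; congr F; lia.
- have -> : (3 %| (3 * a + 1).+1 = false)%N by lia.
  have -> : (3 %| (3 * a + 1).+2)%N by lia.
  have -> : (3 %| (3 * a + 1).+3 = false)%N by lia.
  by rewrite !add0r addr0; congr F; lia.
- have -> : (3 %| (3 * a + 2).+1)%N by lia.
  have -> : (3 %| (3 * a + 2).+2 = false)%N by lia.
  have -> : (3 %| (3 * a + 2).+3 = false)%N by lia.
  by rewrite !addr0; congr F; lia.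
Qed.

(* Trisection: taking every third coefficient of g f^(3b+r) turns f^(3b), which
   is f^b(z^3) modulo 3, into the factor f^b. *)
Lemma fps_mul_exp_section_mod3 (g f : fps) (a b s r : nat) : (s < 3)%N ->
  (fps_mul g (fps_exp f (3 * b + r)) (3 * a + s)%N =
   fps_mul (fun m => fps_mul g (fps_exp f r) (3 * m + s)%N) (fps_exp f b) a
   %[mod 3])%Z.
Proof.
move=> s3; apply/eqz_mod3E.
have hg := @trunc_rep_poly (3 * a + s).+1 g.
have hf := @trunc_rep_poly (3 * a + s).+1 f.
set P := (X in trunc_rep _ g X) in hg; set F := (X in trunc_rep _ f X) in hf.
rewrite (trunc_rep_mul hg (trunc_rep_exp _ hf)) ?ltnSn //.
have -> : P * F ^+ (3 * b + r) = (F ^+ b \Po 'X^3) * (P * F ^+ r).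
  by rewrite -exp3_poly_F3 -exprM exprD [(b * 3)%N]mulnC; ring.
rewrite coefM rmorph_sum /=.
(* The factor F^b(X^3) contributes only at the indices 3k, which leaves 3(a-k)+s for the other
   factor. *)
pose T k := (F ^+ b)`_k * (P * F ^+ r)`_(3 * (a - k) + s).
transitivity (\sum_(k < (3 * a + s).+1 | (3 %| k)%N) T (k %/ 3)%N).
  rewrite [RHS]big_mkcond; apply: eq_bigr => k _.
  rewrite coef_comp_poly_Xn //; case: ifP => [k3|_]; last by rewrite mul0r.
  by rewrite /T; congr (_ * _`_ _); have := ltn_ord k; lia.
(* The sum is reversed because f^b is the second factor of the target product. *)
rewrite sum_ord_mul3 // (reindex_inj rev_ord_inj) /=; apply: eq_bigr => k _.
have := ltn_ord k; rewrite ltnS subSS /T => ka.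
rewrite rmorphM /= mulrC (trunc_rep_exp _ hf); last by lia.
rewrite (trunc_rep_mul hg (trunc_rep_exp _ hf)); last by lia.
by rewrite subKn.
Qed.

(** * Sections as second derivatives modulo 3 *)

Lemma fps_mul_eq_mod3 (p p' q : fps) (m : nat) :
  (forall k, (p k = p' k %[mod 3])%Z) ->
  (fps_mul p q m = fps_mul p' q m %[mod 3])%Z.
Proof.
move=> pp'; apply/eqz_mod3E; rewrite !rmorph_sum; apply: eq_bigr => k _.
by rewrite !rmorphM /=; congr (_ * _); apply/eqz_mod3E.
Qed.

Lemma fps_mul_opp (p q : fps) (m : nat) :
  fps_mul (fps_opp p) q m = - fps_mul p q m.
Proof. by rewrite /fps_mul -sumrN; apply: eq_bigr => k _; rewrite mulNr. Qed.

Lemma fps_mul_mulX (p q : fps) (m : nat) :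
  fps_mul (fps_mulXn 1 p) q m = fps_mulXn 1 (fps_mul p q) m.
Proof.
case: m => [|m]; first by rewrite /fps_mul big_ord1 mul0r.
rewrite /fps_mul big_ord_recl mul0r add0r /fps_mulXn /= subn1 /=.
by apply: eq_bigr => k _; rewrite /bump /= add1n !subn1 subSS.
Qed.

Lemma deriv2_cbrt_mod3 (h : fps) (m : nat) :
  (deriv2_cbrt h m = - h (3 * m + 2)%N %[mod 3])%Z.
Proof.
apply/eqP; rewrite eqz_mod_dvd /deriv2_cbrt /fps_deriv addn2 opprK.
(* (3m+1)(3m+2) + 1 = 3(3m^2+3m+1). *)
apply/dvdzP; exists ((3 * m * m + 3 * m + 1)%N%:Z * h (3 * m).+2).
by set x := h _; lia.
Qed.

Lemma skew_adjC n (G : ograph n) (u v : 'I_n) :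
  skew_adj G u v = - skew_adj G v u.
Proof.
rewrite !mxE; case Guv: (G u v); first by rewrite (negbTE (arc_asym Guv)) opprK.
by case: (G v u); rewrite ?oppr0.
Qed.

(* Multiplying g by z turns the index u - 1 into u, which removes the boundary
   case u = 0. *)
Lemma skew_adj_oriordan_mulX n (g f : fps) (u v : 'I_n) : (v < u)%N ->
  (skew_adj (oriordan n g f) u v
   = fps_mul (fps_mulXn 1 g) (fps_exp f v) u %[mod 3])%Z.
Proof.
move=> vu; rewrite skew_adj_oriordan // fps_mul_mulX /fps_mulXn.
by rewrite ltnNge subn1 (leq_ltn_trans _ vu).
Qed.

(** The index 3m+i-1 in g f^j is 3(m-1)+2 after division by z^i; the outer factor z turns m-1 into
    m. *)
Lemma coef_below_diag (g f : fps) (i j m : nat) : f 0%N = 0 ->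
  (i <= j)%N -> (j < 3)%N ->
  (fps_mul (fps_mulXn 1 g) (fps_exp f j) (3 * m + i)%N =
   fps_opp (fps_mulXn 1 (deriv2_cbrt
     (fps_divXn i (fps_mul g (fps_exp f j))))) m %[mod 3])%Z.
Proof.
move=> f0 ij j3; rewrite fps_mul_mulX /fps_opp /fps_mulXn subn1.
(* For m = 0 the right side is 0, and so is the left: either i = 0, or i-1 < j and z^j divides
   f^j. *)
case: m => [|m].
  rewrite muln0 add0n /= oppr0; case: ltnP => // i0.
  by rewrite fps_mul_exp_low //; lia.
have -> : (3 * m.+1 + i < 1)%N = false by lia.
apply/eqz_mod3E; rewrite mulrNz (iffLR (eqz_mod3E _ _) (deriv2_cbrt_mod3 _ _)).
by rewrite mulrNz opprK /fps_divXn; congr (fps_mul _ _ _)%:~R; lia.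
Qed.

(** Multiplication by z^(3-j) moves the index 3m+j-1 to 3m+2, the one read by the second
    derivative. *)
Lemma coef_above_diag (g f : fps) (i j m : nat) : (0 < j < 3)%N ->
  (fps_mul (fps_mulXn 1 g) (fps_exp f i) (3 * m + j)%N =
   fps_opp (deriv2_cbrt (fps_mulXn (3 - j) (fps_mul g (fps_exp f i)))) m
   %[mod 3])%Z.
Proof.
move=> j3; rewrite fps_mul_mulX; apply/eqz_mod3E.
rewrite mulrNz (iffLR (eqz_mod3E _ _) (deriv2_cbrt_mod3 _ _)) mulrNz opprK.
rewrite /fps_mulXn.
have -> : (3 * m + j < 1)%N = false by lia.
have -> : (3 * m + 2 < 3 - j)%N = false by lia.
by congr (fps_mul _ _ _)%:~R; lia.
Qed.

(** * Enumeration of the residue classes *)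

(** Both sequences are strictly increasing with the same elements. The bound on n makes the
    subtraction in [ell] exact. *)
Lemma val_enum_residue_class n i : (i < 3)%N -> (3 <= n)%N ->
  map val (enum (residue_class n i.+1)) =
    [seq 3 * k + i | k <- iota 0 (ell n i.+1)]%N.
Proof.
move=> i3 n3; apply: (irr_sorted_eq ltn_trans ltnn).
- apply: (subseq_sorted ltn_trans _ (iota_ltn_sorted 0 n)).
  by rewrite -val_enum_ord map_subseq // [enum 'I_n]enumT filter_subseq.
- rewrite sorted_map; apply: sub_sorted (iota_ltn_sorted 0 _) => x y /=; lia.
move=> x; apply/mapP/mapP => [[v]|[k]].
  rewrite mem_enum inE => vi ->; exists (v %/ 3)%N; last by move: vi => /=; lia.
  by rewrite mem_iota /ell /=; have := ltn_ord v; lia.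
rewrite mem_iota /ell /= => kn ->.
have lt_n : (3 * k + i < n)%N by lia.
by exists (Ordinal lt_n) => //; rewrite mem_enum inE /=; lia.
Qed.

Lemma card_residue_class n i : (i < 3)%N -> (3 <= n)%N ->
  #|residue_class n i.+1| = ell n i.+1.
Proof.
move=> i3 n3.
by rewrite cardE -(size_map val) val_enum_residue_class // size_map size_iota.
Qed.

Lemma enum_val_residue_class n i (a : 'I_#|residue_class n i.+1|) :
  (i < 3)%N -> (3 <= n)%N -> enum_val a = (3 * a + i)%N :> nat.
Proof.
move=> i3 n3.
rewrite (enum_val_nth (enum_val a)) -(nth_map _ 0%N val) -?cardE //.
have al : (a < ell n i.+1)%N by rewrite -card_residue_class.
by rewrite val_enum_residue_class // (nth_map 0%N) ?size_iota // nth_iota.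
Qed.

(** * Induced subgraphs and blocks *)

(** Trisection with s = i and r = j, then [coef_below_diag] on the section. The case i = j serves
    the induced subgraphs, i < j the blocks. *)
Lemma skew_adj_below_diag n (g f : fps) (i j a c : nat) (u v : 'I_n) :
  f 0%N = 0 -> (i <= j)%N -> (j < 3)%N ->
  u = (3 * a + i)%N :> nat -> v = (3 * c + j)%N :> nat -> (v < u)%N ->
  (skew_adj (oriordan n g f) u v =
   fps_mul (fps_opp (fps_mulXn 1 (deriv2_cbrt
     (fps_divXn i (fps_mul g (fps_exp f j)))))) (fps_exp f c) a %[mod 3])%Z.
Proof.
move=> f0 ij j3 eu ev /skew_adj_oriordan_mulX->; rewrite eu ev.
rewrite fps_mul_exp_section_mod3 ?(leq_ltn_trans ij) //.
by apply: fps_mul_eq_mod3 => k; apply: coef_below_diag.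
Qed.

(** The transposed entry lies below the diagonal, so trisection applies with s = j and r = i; the
    sign from skew-symmetry cancels that of [coef_above_diag]. *)
Lemma skew_adj_above_diag n (g f : fps) (i j a c : nat) (u v : 'I_n) :
  (0 < j < 3)%N ->
  u = (3 * a + i)%N :> nat -> v = (3 * c + j)%N :> nat -> (u < v)%N ->
  (skew_adj (oriordan n g f) u v =
   fps_mul (deriv2_cbrt (fps_mulXn (3 - j) (fps_mul g (fps_exp f i))))
     (fps_exp f a) c %[mod 3])%Z.
Proof.
move=> /[dup] /andP[_ j3] j03 eu ev uv; rewrite skew_adjC; apply/eqz_mod3E.
rewrite mulrNz (iffLR (eqz_mod3E _ _) (skew_adj_oriordan_mulX g f uv)) eu ev.
rewrite (iffLR (eqz_mod3E _ _) (fps_mul_exp_section_mod3 _ _ _ _ _ j3)).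
rewrite -mulrNz -fps_mul_opp; apply/eqz_mod3E.
apply: fps_mul_eq_mod3 => k; apply/eqz_mod3E.
rewrite mulrNz (iffLR (eqz_mod3E _ _) (coef_above_diag _ _ _ _ j03)).
by rewrite mulrNz opprK.
Qed.

(** The entries 1, -1 and 0 are pairwise incongruent modulo 3. *)
Lemma arc_eq_of_skew_adj_mod3 m n (G : ograph m) (H : ograph n) u v u' v' :
  (skew_adj G u v = skew_adj H u' v' %[mod 3])%Z -> G u v = H u' v'.
Proof.
by rewrite !mxE; case: (G u v); case: (G v u); case: (H u' v'); case: (H v' u').
Qed.

Lemma induced_residue_class_iso n (g f : fps) (i : nat) :
  f 0%N = 0 -> (i < 3)%N -> (3 <= n)%N ->
  ograph_iso (induced (oriordan n g f) (residue_class n i.+1))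
    (oriordan (ell n i.+1)
      (fps_opp (deriv2_cbrt (fps_divXn i (fps_mul g (fps_exp f i))))) f).
Proof.
move=> f0 i3 n3; have e := card_residue_class i3 n3.
exists (cast_ord e).
  by exists (cast_ord (esym e)) => x; rewrite (cast_ordK, cast_ordKV).
(* Entries below the diagonal suffice: skew-symmetry gives those above, and there are no loops. *)
have below (a b : 'I_#|residue_class n i.+1|) : (b < a)%N ->
    (skew_adj (induced (oriordan n g f) (residue_class n i.+1)) a b =
     skew_adj (oriordan (ell n i.+1) (fps_opp (deriv2_cbrt
       (fps_divXn i (fps_mul g (fps_exp f i))))) f)
       (cast_ord e a) (cast_ord e b) %[mod 3])%Z.
  move=> ba; rewrite skew_adj_oriordan_mulX // [skew_adj _ a b]mxE /=.
  have ea := enum_val_residue_class a i3 n3.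
  have eb := enum_val_residue_class b i3 n3.
  have := skew_adj_below_diag g f0 (leqnn i) i3 ea eb; rewrite mxE => ->.
    apply: fps_mul_eq_mod3 => k; rewrite /fps_opp /fps_mulXn.
    by case: ifP; rewrite ?oppr0.
  by rewrite ea eb; lia.
move=> a b; case: (ltngtP b a) => [ba|ab|/val_inj->].
- exact/arc_eq_of_skew_adj_mod3/below.
- apply: arc_eq_of_skew_adj_mod3; rewrite skew_adjC [in RHS]skew_adjC.
  by apply/eqz_mod3E; rewrite !mulrNz (iffLR (eqz_mod3E _ _) (below _ _ ab)).
- by rewrite /= /oriordan_arc !ltnn.
Qed.

Lemma edge_block_residue_class n (g f : fps) (i j : nat)
    (ei : #|residue_class n i.+1| = ell n i.+1)
    (ej : #|residue_class n j.+1| = ell n j.+1) :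
  f 0%N = 0 -> (i < j)%N -> (j < 3)%N -> (3 <= n)%N ->
  eqmx_mod3
    (castmx (ei, ej) (edge_block (oriordan n g f) (residue_class n i.+1)
      (residue_class n j.+1)))
    (riordan_mx (fps_opp (fps_mulXn 1 (deriv2_cbrt
       (fps_divXn i (fps_mul g (fps_exp f j)))))) f (ell n i.+1) (ell n j.+1)
     + (riordan_mx (deriv2_cbrt
          (fps_mulXn (3 - j) (fps_mul g (fps_exp f i)))) f
          (ell n j.+1) (ell n i.+1))^T).
Proof.
move=> f0 ij j3 n3 a c; have i3 := ltn_trans ij j3.
rewrite castmxE [edge_block _ _ _ _ _]mxE [fun_of_matrix (_ + _) a c]mxE.
rewrite [trmx _ _ _]mxE ![riordan_mx _ _ _ _ _ _]mxE.
have /= ea := enum_val_residue_class (cast_ord (esym ei) a) i3 n3.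
have /= ec := enum_val_residue_class (cast_ord (esym ej) c) j3 n3.
(* As i < j < 3, the vertex 3a+i precedes 3c+j exactly when a <= c. *)
case: (leqP a c) => ac.
- rewrite (skew_adj_above_diag g f _ ea ec); [|lia|by rewrite ea ec; lia].
  (* The factor z lowers the index to a-1 < c, so the first matrix vanishes even at a = c. *)
  rewrite [X in X + _](_ : _ = 0) ?add0r // fps_mul_opp fps_mul_mulX /fps_mulXn.
  by case: ltnP => [_|a0]; rewrite ?fps_mul_exp_low ?oppr0 //; lia.
- rewrite (skew_adj_below_diag g f0 (ltnW ij) j3 ea ec); last first.
    by rewrite ea ec; lia.
  by rewrite [X in _ + X]fps_mul_exp_low // addr0.
Qed.

(** * Permutation similarity *)

(** Once [e] identifies m with n, the injection is a permutation, and reindexing is conjugation by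
    its matrix. *)
Lemma perm_similar_mxsub m n (M : 'M[int]_n) (e : m = n)
    (phi : 'I_m -> 'I_n) :
  injective phi -> perm_similar M (castmx (e, e) (mxsub phi phi M)).
Proof.
case: _ / e in M phi *; move=> inj_phi; exists (perm_mx (perm inj_phi)).
  by apply/is_perm_mxP; exists (perm inj_phi).
rewrite tr_perm_mx -col_permE -row_permE castmx_id.
by apply/matrixP => u v; rewrite !mxE !permE.
Qed.

Lemma perm_similar_block3 n (G : ograph n) (A B C : {set 'I_n})
    (e : (#|A| + (#|B| + #|C|) = n)%N) :
  [disjoint A & B] -> [disjoint A & C] -> [disjoint B & C] ->
  perm_similar (skew_adj G)
    (castmx (e, e)
      (block_mx (skew_adj (induced G A))
                (row_mx (edge_block G A B) (edge_block G A C))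
        (col_mx (- (edge_block G A B)^T) (- (edge_block G A C)^T))
        (block_mx (skew_adj (induced G B)) (edge_block G B C)
                  (- (edge_block G B C)^T) (skew_adj (induced G C))))).
Proof.
move=> AB AC BC.
(* [phi] lists A, then B, then C, each increasingly; disjointness makes it injective. *)
pose phi (x : 'I_(#|A| + (#|B| + #|C|))) : 'I_n :=
  match split x with
  | inl a => enum_val a
  | inr y => match split y with inl b => enum_val b | inr c => enum_val c end
  end.
have phi_inj : injective phi.
  have neq (D E : {set 'I_n}) (x : 'I_#|D|) (y : 'I_#|E|) :
      [disjoint D & E] -> enum_val x <> enum_val y.
    move=> /disjointFr/(_ (enum_valP x)) + xy.
    by rewrite xy enum_valP.
  move=> x y; rewrite /phi.
  case: (split_ordP x) => [a ->|x' ->]; case: (split_ordP y) => [b ->|y' ->].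
  - by move/enum_val_inj->.
  - by case: (split y') => [b|c] /neq [].
  - by case: (split x') => [a|c] /esym/neq [].
  case: (split_ordP x') => [a ->|c ->]; case: (split_ordP y') => [b ->|d ->].
  - by move/enum_val_inj->.
  - by move/neq; case.
  - by move/esym/neq; case.
  - by move/enum_val_inj->.
set M := block_mx _ _ _ _; suff -> : M = mxsub phi phi (skew_adj G).
  exact: perm_similar_mxsub.
(* [mxE] also unfolds [skew_adj]; [skE] folds it back, so that [skew_adjC] settles the blocks below
   the diagonal. *)
have skE (u v : 'I_n) :
    (if G u v then 1 else if G v u then -1 else 0) = skew_adj G u v.
  by rewrite mxE.
apply/matrixP => x y; rewrite !mxE /phi.
case: (split x) => [a|x']; rewrite !mxE; case: (split y) => [b|y'];
  rewrite !mxE /= ?skE //.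
- by case: (split y') => d; rewrite !mxE.
- by case: (split x') => d; rewrite !mxE !skE [RHS]skew_adjC.
case: (split x') => c; rewrite !mxE; case: (split y') => d;
  rewrite !mxE /= ?skE // [RHS]skew_adjC //.
Qed.

Lemma residue_class_disjoint n (i j : nat) : i != j %[mod 3] ->
  [disjoint residue_class n i & residue_class n j].
Proof.
move=> ij; apply/pred0P => v /=; rewrite !inE.
by apply: contraNF ij => /andP[/eqP <- /eqP <-].
Qed.

Theorem theorem3p7 (n : nat) (g f : fps) (hn : (3 <= n)%N) (hf : f 0%N = 0) :
  let G := oriordan n g f in
  let V := residue_class n in
  let X := fun i : nat => skew_adj (induced G (V i)) in
  let B := fun i j : nat => edge_block G (V i) (V j) in
  [/\ exists e : (#|V 1| + (#|V 2| + #|V 3|) = n)%N,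
        perm_similar (skew_adj G)
          (castmx (e, e)
            (block_mx (X 1%N) (row_mx (B 1%N 2%N) (B 1%N 3%N))
              (col_mx (- (B 1%N 2%N)^T) (- (B 1%N 3%N)^T))
              (block_mx (X 2%N)           (B 2%N 3%N)
                        (- (B 2%N 3%N)^T) (X 3%N)))),
      forall i : nat, (1 <= i <= 3)%N ->
        ograph_iso (induced G (V i))
          (oriordan (ell n i)
            (fps_opp (deriv2_cbrt
              (fps_divXn (i - 1) (fps_mul g (fps_exp f (i - 1))))))
            f)
    & forall i j : nat, (1 <= i)%N -> (i < j)%N -> (j <= 3)%N ->
        exists (ei : #|V i| = ell n i) (ej : #|V j| = ell n j),
          eqmx_mod3 (castmx (ei, ej) (B i j))
            (riordan_mx
               (fps_opp (fps_mulXn 1 (deriv2_cbrt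
                 (fps_divXn (i - 1) (fps_mul g (fps_exp f (j - 1)))))))
               f (ell n i) (ell n j)
             + (riordan_mx
                  (deriv2_cbrt
                    (fps_mulXn (4 - j) (fps_mul g (fps_exp f (i - 1)))))
                  f (ell n j) (ell n i))^T)].
Proof.
move=> G V X B; split.
- have e : (#|V 1| + (#|V 2| + #|V 3|) = n)%N.
    by rewrite /V !card_residue_class // /ell; lia.
  by exists e; apply: perm_similar_block3; apply: residue_class_disjoint.
- move=> [|i] //= i3; rewrite subn1 /=.
  exact: induced_residue_class_iso.
(* The lemmas number the classes from 0, so the exponent 4 - j becomes 3 - j. *)
- move=> [|i] [|j] //= _ ij j3.
  have i3 : (i < 3)%N by lia.
  exists (card_residue_class i3 hn), (card_residue_class j3 hn).
  by rewrite !subn1 subSS; apply: edge_block_residue_class.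
Qed.
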